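(* Let $\mathcal{A}$ be a Grothendieck category with a generator $U$, let $R=\mathrm{End}_{\mathcal{A}}(U)$, let $S=\mathrm{Hom}_{\mathcal{A}}(U,-):\mathcal{A}\to \mathrm{Mod}(R)$, and let $M$ and $N$ be objects of $\mathcal{A}$. Then $N$ is an $M$-Rickart object of $\mathcal{A}$ if and only if $S(N)$ is an $S(M)$-Rickart right $R$-module.
   Context: $\mathrm{Mod}(R)$ is the category of right $R$-modules; $\mathrm{Hom}_{\mathcal{A}}(U,X)$ is a right $R$-module by composition. For objects $M,N$ of an abelian category, $N$ is called $M$-Rickart if for every morphism $f:M\to N$ the kernel $\mathrm{Ker}(f)\to M$ is a split monomorphism (equivalently, $\mathrm{Ker}(f)$ is a direct summand of $M$). A right $R$-module is $M$-Rickart if it is so as an object of $\mathrm{Mod}(R)$. *)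

(* Defs.v *)
From HB Require Import structures.
From mathcomp Require Import all_boot all_algebra boolp.

Set Implicit Arguments.
Unset Strict Implicit.
Unset Printing Implicit Defensive.

Import GRing.Theory.
Local Open Scope ring_scope.
Local Open Scope quotient_scope.

Reserved Notation "g \oc f" (at level 40, left associativity).

Record preadditiveCategory := PreadditiveCategory {
  obj :> Type;
  Hom : obj -> obj -> zmodType;
  idm : forall X, Hom X X;
  comp : forall X Y Z, Hom Y Z -> Hom X Y -> Hom X Z;
  comp1m : forall X Y (f : Hom X Y), comp (idm Y) f = f;
  compm1 : forall X Y (f : Hom X Y), comp f (idm X) = f;
  compA : forall W X Y Z (h : Hom Y Z) (g : Hom X Y) (f : Hom W X),
    comp h (comp g f) = comp (comp h g) f;
  compDl : forall X Y Z (g g' : Hom Y Z) (f : Hom X Y),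
    comp (g + g') f = comp g f + comp g' f;
  compDr : forall X Y Z (g : Hom Y Z) (f f' : Hom X Y),
    comp g (f + f') = comp g f + comp g f'
}.

Arguments Hom {p} X Y.
Arguments idm {p} X.
Arguments comp {p X Y Z} g f.

Notation "g \oc f" := (comp g f) : ring_scope.

Record additiveFunctor (C D : preadditiveCategory) := AdditiveFunctor {
  fobj :> C -> D;
  fmap : forall X Y, Hom X Y -> Hom (fobj X) (fobj Y);
  fmap1 : forall X, fmap (idm X) = idm (fobj X);
  fmapM : forall X Y Z (g : Hom Y Z) (f : Hom X Y),
    fmap (g \oc f) = fmap g \oc fmap f;
  fmapD : forall X Y (f g : Hom X Y), fmap (f + g) = fmap f + fmap g
}.

Arguments fmap {C D} a {X Y} f.

Section PreadditiveTheory.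
Variable C : preadditiveCategory.
Implicit Types X Y Z : C.

Lemma comp0m X Y Z (f : Hom X Y) : (0 : Hom Y Z) \oc f = 0.
Proof. by apply: (addrI (0 \oc f)); rewrite -compDl !addr0. Qed.

Lemma compm0 X Y Z (g : Hom Y Z) : g \oc (0 : Hom X Y) = 0.
Proof. by apply: (addrI (g \oc 0)); rewrite -compDr !addr0. Qed.

Definition monic X Y (f : Hom X Y) :=
  forall W (u v : Hom W X), f \oc u = f \oc v -> u = v.

Definition epic X Y (f : Hom X Y) :=
  forall W (u v : Hom Y W), u \oc f = v \oc f -> u = v.

Definition split_mono X Y (f : Hom X Y) := exists r : Hom Y X, r \oc f = idm X.

Definition is_kernel X Y (f : Hom X Y) K (k : Hom K X) :=
  f \oc k = 0 /\
  forall W (u : Hom W X), f \oc u = 0 -> exists! v : Hom W K, k \oc v = u.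

Definition is_cokernel X Y (f : Hom X Y) Q (q : Hom Y Q) :=
  q \oc f = 0 /\
  forall W (u : Hom Y W), u \oc f = 0 -> exists! v : Hom Q W, v \oc q = u.

Definition is_zero_object Z :=
  (forall X (f : Hom X Z), f = 0) /\ (forall X (f : Hom Z X), f = 0).

Definition is_biproduct X Y P (i1 : Hom X P) (i2 : Hom Y P)
    (p1 : Hom P X) (p2 : Hom P Y) :=
  [/\ p1 \oc i1 = idm X, p2 \oc i2 = idm Y, p1 \oc i2 = 0, p2 \oc i1 = 0
    & i1 \oc p1 + i2 \oc p2 = idm P].

Record is_abelian : Prop := IsAbelian {
  has_zero_object : exists Z, is_zero_object Z;
  has_biproducts : forall X Y, exists P i1 i2 p1 p2,
    @is_biproduct X Y P i1 i2 p1 p2;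
  has_kernels : forall X Y (f : Hom X Y), exists K (k : Hom K X),
    is_kernel f k;
  has_cokernels : forall X Y (f : Hom X Y), exists Q (q : Hom Y Q),
    is_cokernel f q;
  monic_normal : forall X Y (f : Hom X Y), monic f ->
    exists Z (g : Hom Y Z), is_kernel g f;
  epic_normal : forall X Y (f : Hom X Y), epic f ->
    exists Z (g : Hom Z X), is_cokernel g f
}.

(* Exactness at Y of X -f-> Y -g-> Z: as k is monic, the factorization
   f = k \oc e exhibits Ker g as the image of f. *)
Definition exact X Y Z (f : Hom X Y) (g : Hom Y Z) :=
  exists K (k : Hom K Y) (e : Hom X K), [/\ is_kernel g k, epic e & k \oc e = f].

Definition is_coproduct (I : Type) (X : I -> C) P (inj : forall i, Hom (X i) P) :=
  forall W (u : forall i, Hom (X i) W),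
    exists! v : Hom P W, forall i, v \oc inj i = u i.

Definition is_generator (U : C) :=
  forall X Y (f g : Hom X Y),
    (forall u : Hom U X, f \oc u = g \oc u) -> f = g.

End PreadditiveTheory.

Definition directed (I : Type) (le : I -> I -> Prop) :=
  [/\ inhabited I, forall i, le i i,
      forall i j k, le i j -> le j k -> le i k
    & forall i j, exists2 k, le i k & le j k].

(* dsmap does not depend on the proof of le i j, by the last two fields. *)
Record directSystem (C : preadditiveCategory) (I : Type) (le : I -> I -> Prop) :=
  DirectSystem {
    dsobj :> I -> C;
    dsmap : forall i j, le i j -> Hom (dsobj i) (dsobj j);
    dsmap1 : forall i (ii : le i i), dsmap ii = idm (dsobj i);
    dsmapM : forall i j k (ij : le i j) (jk : le j k) (ik : le i k),
      dsmap jk \oc dsmap ij = dsmap ik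
  }.

Arguments dsmap {C I le} d {i j} ij.

Section DirectLimits.
Variables (C : preadditiveCategory) (I : Type) (le : I -> I -> Prop).
Implicit Types F G H : directSystem C le.

Definition is_cocone F (L : C) (c : forall i, Hom (F i) L) :=
  forall i j (ij : le i j), c j \oc dsmap F ij = c i.

Definition is_direct_limit F (L : C) (c : forall i, Hom (F i) L) :=
  is_cocone c /\
  forall W (u : forall i, Hom (F i) W), is_cocone u ->
    exists! v : Hom L W, forall i, v \oc c i = u i.

Definition is_natural F G (a : forall i, Hom (F i) (G i)) :=
  forall i j (ij : le i j), a j \oc dsmap F ij = dsmap G ij \oc a i.

End DirectLimits.

(* For an abelian category this is cocompleteness: cokernels exist. *)
Definition AB3 (C : preadditiveCategory) :=
  forall (I : Type) (X : I -> C),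
    exists P (inj : forall i, Hom (X i) P), is_coproduct inj.

(* Direct limits of exact sequences are exact; f and g below are the morphisms
   induced by a and b on the direct limits. *)
Definition exact_direct_limits (C : preadditiveCategory) :=
  forall (I : Type) (le : I -> I -> Prop), directed le ->
  forall (F G H : directSystem C le)
    (a : forall i, Hom (F i) (G i)) (b : forall i, Hom (G i) (H i)),
    is_natural a -> is_natural b -> (forall i, exact (a i) (b i)) ->
  forall (LF LG LH : C) (cF : forall i, Hom (F i) LF)
    (cG : forall i, Hom (G i) LG) (cH : forall i, Hom (H i) LH),
    is_direct_limit cF -> is_direct_limit cG -> is_direct_limit cH ->
  forall (f : Hom LF LG) (g : Hom LG LH),
    (forall i, f \oc cF i = cG i \oc a i) ->
    (forall i, g \oc cG i = cH i \oc b i) ->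
  exact f g.

Record abelianCategory := AbelianCategory {
  abelian_cat :> preadditiveCategory;
  abelianP : is_abelian abelian_cat
}.

Record grothendieckCategory := GrothendieckCategory {
  grothendieck_cat :> abelianCategory;
  grothendieck_AB3 : AB3 grothendieck_cat;
  grothendieck_AB5 : exact_direct_limits grothendieck_cat;
  grothendieck_generator : exists U : grothendieck_cat, is_generator U
}.

(* rickart M N: N is M-Rickart.  Kernels exist in A and are unique up to
   isomorphism, so that it is harmless to quantify over all kernels of f. *)
Definition rickart (A : abelianCategory) (M N : A) :=
  forall (f : Hom M N) (K : A) (k : Hom K M), is_kernel f k -> split_mono k.

Definition End (C : preadditiveCategory) (U : C) : Type := Hom U U.

Section EndRing.
Variables (C : preadditiveCategory) (U : C).

HB.instance Definition _ := GRing.Zmodule.on (End U).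

Definition end_mul (f g : End U) : End U := comp (f : Hom U U) (g : Hom U U).

Fact end_mulA : associative end_mul.
Proof. by move=> f g h; apply: compA. Qed.
Fact end_mul1l : left_id (idm U : End U) end_mul.
Proof. by move=> f; apply: comp1m. Qed.
Fact end_mul1r : right_id (idm U : End U) end_mul.
Proof. by move=> f; apply: compm1. Qed.
Fact end_mulDl : left_distributive end_mul +%R.
Proof. by move=> f g h; apply: compDl. Qed.
Fact end_mulDr : right_distributive end_mul +%R.
Proof. by move=> f g h; apply: compDr. Qed.

HB.instance Definition _ := GRing.Zmodule_isPzRing.Build (End U)
  end_mulA end_mul1l end_mul1r end_mulDl end_mulDr.

End EndRing.

(* Right R-modules are left modules over the converse ring R^c: the right
   action x . r is written r *: x. *)
Section RightModules.
Variable R : pzRingType.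
Implicit Types M N P K Q : lmodType R^c.

Section LinearZmodule.
Variables M N : lmodType R^c.
Implicit Types f g h : {linear M -> N}.

HB.instance Definition _ := gen_eqMixin {linear M -> N}.
HB.instance Definition _ := gen_choiceMixin {linear M -> N}.

Definition linear_zero : {linear M -> N} := \0.
Definition linear_add f g : {linear M -> N} := f \+ g.
Definition linear_opp f : {linear M -> N} := -%R \o f.

Lemma linear_ext f g : f =1 g -> f = g.
Proof.
move=> /funext; case: f g => [f [[f1] [f2] ]] [g [[g1] [g2] ]] /= fg.
by subst g; congr GRing.Linear.Pack; congr GRing.Linear.Class;
  [congr Algebra.isNmodMorphism.Axioms_|congr GRing.isScalable.Axioms_];
  apply: Prop_irrelevance.
Qed.

Fact linear_addA : associative linear_add.
Proof. by move=> f g h; apply: linear_ext => x /=; rewrite addrA. Qed.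
Fact linear_addC : commutative linear_add.
Proof. by move=> f g; apply: linear_ext => x /=; rewrite addrC. Qed.
Fact linear_add0 : left_id linear_zero linear_add.
Proof. by move=> f; apply: linear_ext => x /=; rewrite add0r. Qed.
Fact linear_addN : left_inverse linear_zero linear_opp linear_add.
Proof. by move=> f; apply: linear_ext => x /=; rewrite addNr. Qed.

HB.instance Definition _ := GRing.isZmodule.Build {linear M -> N}
  linear_addA linear_addC linear_add0 linear_addN.

End LinearZmodule.

Definition linear_id M : {linear M -> M} := idfun.
Definition linear_comp M N P (g : {linear N -> P}) (f : {linear M -> N}) :
  {linear M -> P} := g \o f.

Definition rMod_preadditive : preadditiveCategory.
Proof.
apply: (@PreadditiveCategory (lmodType R^c)
  (fun M N => {linear M -> N} : zmodType) linear_id linear_comp).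
- by move=> M N f; apply: linear_ext.
- by move=> M N f; apply: linear_ext.
- by move=> M N P Q h g f; apply: linear_ext.
- by move=> M N P g g' f; apply: linear_ext.
- by move=> M N P g f f'; apply: linear_ext => x /=; rewrite linearD.
Defined.

Section Submodule.
Variables (M : lmodType R^c) (S : submodClosed M).

Record subm := Subm { subm_val : M; subm_valP : subm_val \in S }.
HB.instance Definition _ := [isSub for subm_val].
HB.instance Definition _ := [Choice of subm by <:].
HB.instance Definition _ := [SubChoice_isSubLmodule of subm by <:].

Definition subm_incl : {linear subm -> M} := val.

Definition quotm_pred : {pred M} := S.

Fact quotm_pred_closed : zmod_closed quotm_pred.
Proof.
by split=> [|x y Sx Sy]; rewrite ?rpred0 // -scaleN1r rpredD // rpredZ.
Qed.
HB.instance Definition _ :=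
  GRing.isZmodClosed.Build M quotm_pred quotm_pred_closed.

Local Notation Q := (Quotient.quot quotm_pred).

Definition quotm : Type := Q.
HB.instance Definition _ := GRing.Zmodule.on quotm.

Definition quotm_pi (x : M) : quotm := \pi_Q x.

Lemma quotm_piE x y : (quotm_pi x = quotm_pi y) <-> (x - y \in S).
Proof.
rewrite -[x - y \in S]/(x - y \in quotm_pred) Quotient.idealrBE.
by split=> /eqP.
Qed.

Lemma quotm_piD x y : quotm_pi (x + y) = quotm_pi x + quotm_pi y.
Proof. exact: (Quotient.pi_add _ x y). Qed.

Definition quotm_scale (a : R^c) (q : quotm) : quotm := quotm_pi (a *: repr q).

Lemma quotm_scaleE a x : quotm_scale a (quotm_pi x) = quotm_pi (a *: x).
Proof.
apply/quotm_piE; rewrite -scalerBr; apply: rpredZ; apply/quotm_piE.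
by rewrite /quotm_pi reprK.
Qed.

Lemma quotm_piW (q : quotm) : exists x, q = quotm_pi x.
Proof. by exists (repr q); rewrite /quotm_pi reprK. Qed.

Fact quotm_scaleA a b q : quotm_scale a (quotm_scale b q) = quotm_scale (a * b) q.
Proof. by have [x ->] := quotm_piW q; rewrite !quotm_scaleE scalerA. Qed.
Fact quotm_scale1 : left_id 1 quotm_scale.
Proof. by move=> q; have [x ->] := quotm_piW q; rewrite quotm_scaleE scale1r. Qed.
Fact quotm_scaleDr : right_distributive quotm_scale +%R.
Proof.
move=> a q r; have [x ->] := quotm_piW q; have [y ->] := quotm_piW r.
by rewrite -quotm_piD !quotm_scaleE scalerDr quotm_piD.
Qed.
Fact quotm_scaleDl q : {morph quotm_scale^~ q : a b / a + b}.
Proof.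
move=> a b; have [x ->] := quotm_piW q.
by rewrite !quotm_scaleE scalerDl quotm_piD.
Qed.

HB.instance Definition _ := GRing.Zmodule_isLmodule.Build R^c quotm
  quotm_scaleA quotm_scale1 quotm_scaleDr quotm_scaleDl.

Fact quotm_pi_linear : linear quotm_pi.
Proof. by move=> a x y; rewrite quotm_piD -quotm_scaleE. Qed.
HB.instance Definition _ :=
  GRing.isLinear.Build R^c M quotm *:%R quotm_pi quotm_pi_linear.

Definition quotm_proj : {linear M -> quotm} := quotm_pi.

End Submodule.

Section KernelImage.
Variables (M N : lmodType R^c) (f : {linear M -> N}).

Definition ker_pred : {pred M} := fun x => f x == 0.
Definition im_pred : {pred N} := fun y => `[< exists x, f x = y >].

Fact ker_pred_closed : submod_closed ker_pred.
Proof.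
split=> [|a x y]; rewrite !unfold_in ?linear0 // => /eqP fx /eqP fy.
by rewrite linearP fx fy scaler0 addr0.
Qed.
HB.instance Definition _ :=
  GRing.isSubmodClosed.Build R^c M ker_pred
    (GRing.submod_closed_semi ker_pred_closed).

Fact im_pred_closed : submod_closed im_pred.
Proof.
split=> [|a x y]; rewrite !unfold_in.
  by apply/asboolP; exists 0; rewrite linear0.
move=> /asboolP[u <-] /asboolP[v <-]; apply/asboolP.
by exists (a *: u + v); rewrite linearP.
Qed.
HB.instance Definition _ :=
  GRing.isSubmodClosed.Build R^c N im_pred
    (GRing.submod_closed_semi im_pred_closed).

End KernelImage.

Notation rMod0 := rMod_preadditive (only parsing).

Lemma rMod_is_kernel M N K (f : {linear M -> N}) (k : {linear K -> M}) :
    injective k -> (forall x, f x = 0 <-> exists y, k y = x) ->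
  @is_kernel rMod0 M N f K k.
Proof.
move=> k_inj kerE; split=> [|W u fu0].
  by apply: linear_ext => y /=; apply/kerE; exists y.
have lift x : exists y, k y = u x.
  by apply/kerE; have /(congr1 (fun h : {linear W -> N} => h x)) := fu0.
pose v x := projT1 (cid (lift x)).
have vE x : k (v x) = u x by rewrite /v; case: cid.
have v_lin : linear v.
  by move=> a x y; apply: k_inj; rewrite linearP !vE linearP.
pose vL := GRing.isLinear.Build R^c W K *:%R v v_lin.
pose w : {linear W -> K} := HB.pack v vL.
exists w; split; first by apply: linear_ext => x; apply: vE.
move=> w' kw'; apply: linear_ext => x; apply: k_inj; rewrite [LHS]vE.
by rewrite -kw'.
Qed.

Lemma rMod_is_cokernel M N Q (f : {linear M -> N}) (q : {linear N -> Q}) :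
    (forall z, exists y, q y = z) -> (forall y, q y = 0 <-> exists x, f x = y) ->
  @is_cokernel rMod0 M N f Q q.
Proof.
move=> q_surj imE; split=> [|W u uf0].
  by apply: linear_ext => x /=; apply/imE; exists x.
have u0 y : q y = 0 -> u y = 0.
  move=> /imE[x <-].
  by have /(congr1 (fun h : {linear M -> W} => h x)) := uf0.
pose s z := projT1 (cid (q_surj z)).
have sE z : q (s z) = z by rewrite /s; case: cid.
have vE y : u (s (q y)) = u y.
  by apply/eqP; rewrite -subr_eq0 -linearB u0 // linearB sE subrr.
have v_lin : linear (fun z => u (s z)).
  move=> a x y; rewrite -[x in LHS]sE -[y in LHS]sE -linearP vE.
  by rewrite linearP.
pose vL := GRing.isLinear.Build R^c Q W *:%R (fun z => u (s z)) v_lin.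
pose w : {linear Q -> W} := HB.pack (fun z => u (s z)) vL.
exists w; split; first by apply: linear_ext => y; apply: vE.
by move=> w' w'q; apply: linear_ext => z /=; rewrite -w'q /= sE.
Qed.

Lemma rMod_ker M N (f : {linear M -> N}) :
  @is_kernel rMod0 M N f (subm (ker_pred f)) (subm_incl (ker_pred f)).
Proof.
apply: rMod_is_kernel => [|x]; first exact: val_inj.
split=> [fx0|[y <-]]; last by apply/eqP; apply: (valP y).
have kx : x \in ker_pred f by apply/eqP.
by exists (Subm kx).
Qed.

Lemma rMod_coker M N (f : {linear M -> N}) :
  @is_cokernel rMod0 M N f (quotm (im_pred f)) (quotm_proj (im_pred f)).
Proof.
apply: rMod_is_cokernel => [z|y].
  by have [x ->] := quotm_piW z; exists x.
rewrite -(linear0 (quotm_proj (im_pred f))) quotm_piE subr0.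
by split=> [/asboolP|?]; last exact/asboolP.
Qed.

Lemma rMod_monic_inj M N (f : {linear M -> N}) :
  @monic rMod0 M N f -> injective f.
Proof.
move=> f_monic x y fxy; apply/eqP; rewrite -subr_eq0; apply/eqP.
have kxy : x - y \in ker_pred f by apply/eqP; rewrite linearB fxy subrr.
have /f_monic/(congr1 (fun h : {linear _ -> M} => h (Subm kxy))) :
    comp (f : Hom (M : rMod0) N) (subm_incl (ker_pred f)) =
    comp (f : Hom (M : rMod0) N) 0 by rewrite compm0; case: (rMod_ker f).
by [].
Qed.

Lemma rMod_epic_surj M N (f : {linear M -> N}) :
  @epic rMod0 M N f -> forall y, exists x, f x = y.
Proof.
move=> f_epic y.
have /f_epic/(congr1 (fun h : {linear N -> _} => h y)) :
    comp (quotm_proj (im_pred f) : Hom (N : rMod0) _) f =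
    comp (0 : Hom (N : rMod0) _) f by rewrite comp0m; case: (rMod_coker f).
rewrite -[RHS](linear0 (quotm_proj (im_pred f))) => /quotm_piE.
by rewrite subr0 => /asboolP.
Qed.

Lemma rMod_biproduct M N : exists (P : rMod0) i1 i2 p1 p2,
  @is_biproduct rMod0 M N P i1 i2 p1 p2.
Proof.
pose P : lmodType R^c := (M * N)%type.
have i1_lin : linear (fun x : M => (x, 0) : P).
  by move=> a x y; apply: injective_projections; rewrite /= ?scaler0 ?addr0.
have i2_lin : linear (fun x : N => (0, x) : P).
  by move=> a x y; apply: injective_projections; rewrite /= ?scaler0 ?addr0.
pose i1L := GRing.isLinear.Build R^c M P *:%R _ i1_lin.
pose i2L := GRing.isLinear.Build R^c N P *:%R _ i2_lin.
pose i1 : {linear M -> P} := HB.pack (fun x : M => (x, 0) : P) i1L.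
pose i2 : {linear N -> P} := HB.pack (fun x : N => (0, x) : P) i2L.
exists P, i1, i2, (fst : {linear P -> M}), (snd : {linear P -> N}).
split; apply: linear_ext => //= -[x y] /=.
by apply: injective_projections; rewrite /= ?addr0 ?add0r.
Qed.

Lemma rMod_is_abelian : is_abelian rMod_preadditive.
Proof.
split.
- exists ('rV[R^c]_0 : lmodType R^c); split=> M f; apply: linear_ext => x.
    exact: thinmx0.
  by rewrite (thinmx0 x) !linear0.
- exact: rMod_biproduct.
- by move=> M N f; eexists; eexists; apply: rMod_ker.
- by move=> M N f; eexists; eexists; apply: rMod_coker.
- move=> M N f f_monic; exists (quotm (im_pred f) : lmodType R^c), (quotm_proj (im_pred f)).
  apply: rMod_is_kernel => [|y]; first exact: rMod_monic_inj.
  rewrite -(linear0 (quotm_proj (im_pred f))) quotm_piE subr0.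
  by split=> [/asboolP|?]; last exact/asboolP.
- move=> M N f f_epic; exists (subm (ker_pred f) : lmodType R^c), (subm_incl (ker_pred f)).
  apply: rMod_is_cokernel => [|x]; first exact: rMod_epic_surj.
  split=> [fx0|[y <-]]; last by apply/eqP; apply: (valP y).
  have kx : x \in ker_pred f by apply/eqP.
  by exists (Subm kx).
Qed.

Definition rMod : abelianCategory := AbelianCategory rMod_is_abelian.

End RightModules.

Section HomFunctor.
Variables (C : preadditiveCategory) (U : C).

Definition homModule (X : C) : Type := Hom U X.

Section HomModule.
Variable X : C.

HB.instance Definition _ := GRing.Zmodule.on (homModule X).

Definition hom_scale (r : (End U)^c) (x : homModule X) : homModule X :=
  comp (x : Hom U X) (r : Hom U U).

Fact hom_scaleA r s x : hom_scale r (hom_scale s x) = hom_scale (r * s) x.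
Proof. by rewrite /hom_scale -compA. Qed.
Fact hom_scale1 : left_id 1 hom_scale.
Proof. by move=> x; apply: compm1. Qed.
Fact hom_scaleDr : right_distributive hom_scale +%R.
Proof. by move=> r x y; apply: compDl. Qed.
Fact hom_scaleDl x : {morph hom_scale^~ x : r s / r + s}.
Proof. by move=> r s; apply: compDr. Qed.

HB.instance Definition _ := GRing.Zmodule_isLmodule.Build (End U)^c
  (homModule X) hom_scaleA hom_scale1 hom_scaleDr hom_scaleDl.

End HomModule.

Section HomMap.
Variables (X Y : C) (f : Hom X Y).

Definition hom_map (x : homModule X) : homModule Y := f \oc (x : Hom U X).

Fact hom_map_linear : linear hom_map.
Proof. by move=> r x y; rewrite /hom_map compDr compA. Qed.
HB.instance Definition _ := GRing.isLinear.Build (End U)^c (homModule X)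
  (homModule Y) *:%R hom_map hom_map_linear.

End HomMap.

Definition homFunctor : additiveFunctor C (rMod (End U)).
Proof.
apply: (@AdditiveFunctor C (rMod (End U))
  (fun X => homModule X : lmodType (End U)^c)
  (fun X Y f => hom_map f : {linear homModule X -> homModule Y})).
- by move=> X; apply: linear_ext => x; apply: comp1m.
- by move=> X Y Z g f; apply: linear_ext => x; rewrite /= /hom_map -compA.
- by move=> X Y f g; apply: linear_ext => x; apply: compDl.
Defined.

End HomFunctor.

(* Main.v *)
Require Import Defs.
From mathcomp Require Import all_boot all_algebra.
From mathcomp Require Import boolp.
(* all_algebra also exports a constant Hom, for linear maps between vector
   spaces; the second import makes Hom denote the morphisms of a category. *)
Import Defs.

(** The functor S = Hom(U, -) is fully faithful and preserves kernels, and any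
    such functor both preserves and reflects the Rickart property.  If g is a
    morphism from S(M) to S(N), then g = S(f) by fullness; when the kernel k0
    of f splits, so does S(k0), which is a kernel of g, and hence so does every
    kernel of g.  Conversely, if k is a kernel of f : M -> N, then S(k) is a
    kernel of S(f); a retraction of S(k) has the form S(r) by fullness, and r
    is a retraction of k by faithfulness.

    Faithfulness is the definition of a generator, and preservation of kernels
    is the left exactness of Hom.  Fullness (homFunctor_full) is half of the
    Gabriel-Popescu theorem and the only place where the Grothendieck axioms
    are used.  The argument is Mitchell's.  Given an R-linear phi from S(M) to
    S(N), take the coproduct P of copies of U indexed by all x : U -> M, and
    let p : P -> M and t : P -> N have components x and phi x.  As U is a
    generator, p is epic, hence a cokernel, and it is enough that t vanishes on
    every w : U -> P killed by p: then t factors as f \oc p, and S(f) = phi.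
    If w lands in a finite subcoproduct, so that w is a finite sum of
    inj x \oc r_x with r_x in R, then p \oc w = 0 says that the sum of the
    x r_x is 0, and applying the R-linear phi gives t \oc w = 0.  A general w
    is reduced to this case by AB5: U is the union of the preimages under w of
    the finite subcoproducts, so that a morphism out of U which vanishes on
    each of these preimages is 0 (coproduct_eq0). *)

Set Implicit Arguments.
Unset Strict Implicit.
Unset Printing Implicit Defensive.

Import GRing.Theory.
Local Open Scope ring_scope.

(** * Kernels, cokernels and coproducts *)

Section Preadditive.
Variable C : preadditiveCategory.
Implicit Types X Y Z : C.

Lemma compBl X Y Z (g g' : Hom Y Z) (f : Hom X Y) :
  (g - g') \oc f = g \oc f - g' \oc f.
Proof. by apply: (addIr (g' \oc f)); rewrite -compDl !subrK. Qed.

Lemma compBr X Y Z (g : Hom Y Z) (f f' : Hom X Y) :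
  g \oc (f - f') = g \oc f - g \oc f'.
Proof. by apply: (addIr (g \oc f')); rewrite -compDr !subrK. Qed.

Lemma comp_suml (I : Type) (r : seq I) X Y Z (g : I -> Hom Y Z) (f : Hom X Y) :
  (\sum_(i <- r) g i) \oc f = \sum_(i <- r) g i \oc f.
Proof.
by apply: (big_morph (fun g => g \oc f)) => [g1 g2|]; rewrite ?compDl ?comp0m.
Qed.

Lemma comp_sumr (I : Type) (r : seq I) X Y Z (g : Hom Y Z) (f : I -> Hom X Y) :
  g \oc (\sum_(i <- r) f i) = \sum_(i <- r) g \oc f i.
Proof.
by apply: (big_morph (fun f => g \oc f)) => [f1 f2|]; rewrite ?compDr ?compm0.
Qed.

Lemma kernel_monic X Y (f : Hom X Y) K (k : Hom K X) : is_kernel f k -> monic k.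
Proof.
move=> [fk0 kU] W u v kuv.
have /kU[w [_ wU]] : f \oc (k \oc u) = 0 by rewrite compA fk0 comp0m.
by rewrite -(wU u) // -(wU v).
Qed.

Lemma cokernel_epic X Y (f : Hom X Y) Q (q : Hom Y Q) :
  is_cokernel f q -> epic q.
Proof.
move=> [qf0 qU] W u v uvq.
have /qU[w [_ wU]] : (u \oc q) \oc f = 0 by rewrite -compA qf0 compm0.
by rewrite -(wU u) // -(wU v).
Qed.

Lemma coproduct_ext (I : Type) (X : I -> C) P (inj : forall i, Hom (X i) P) :
  is_coproduct inj ->
  forall W (u v : Hom P W), (forall i, u \oc inj i = v \oc inj i) -> u = v.
Proof.
move=> copP W u v uv; have [w [_ wU]] := copP W (fun i => u \oc inj i).
by rewrite -(wU u) // -(wU v).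
Qed.

(** Two kernels of the same morphism are isomorphic, so that splitting one of
    them splits the other. *)
Lemma kernel_split_mono X Y (f : Hom X Y) K (k : Hom K X) K' (k' : Hom K' X) :
  is_kernel f k -> is_kernel f k' -> split_mono k -> split_mono k'.
Proof.
move=> kerk kerk' [r rk].
have [v [kv _]] := kerk.2 _ _ kerk'.1; have [v' [kv' _]] := kerk'.2 _ _ kerk.1.
exists (v' \oc r); apply: (kernel_monic kerk').
by rewrite !compA kv' -{1}kv -!compA (compA r) rk comp1m kv compm1.
Qed.

End Preadditive.

(** * Direct systems and direct limits *)

(** The direct limit is the coproduct of the objects of the system modulo the
    differences of inj i and inj j \oc dsmap F ij. *)
Lemma AB3_direct_limit (A : abelianCategory) : AB3 A ->
  forall (I : Type) (le : I -> I -> Prop) (F : directSystem A le),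
  exists L (c : forall i, Hom (F i) L), is_direct_limit c.
Proof.
move=> ab3 I le F.
have [P [inj copP]] := ab3 I F.
pose arrow := {ij : I * I | le ij.1 ij.2}.
have [D [injD copD]] := ab3 arrow (fun a => F (sval a).1).
have [d [dE _]] := copD P (fun a =>
  inj (sval a).1 - inj (sval a).2 \oc dsmap F (proj2_sig a)).
have [L [q cokq]] := has_cokernels (abelianP A) d.
exists L, (fun i => q \oc inj i); split=> [i j ij|W u u_cocone].
  have /(congr1 (fun h => q \oc h)) := dE (exist _ (i, j) ij).
  rewrite compA cokq.1 comp0m compBr /= => /esym/eqP.
  by rewrite subr_eq0 compA => /eqP ->.
have [t [tE _]] := copP W u.
have [|v [vE vU]] := cokq.2 W t.
  apply: (coproduct_ext copD) => a.
  by rewrite -compA dE compBr compA !tE u_cocone subrr comp0m.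
exists v; split=> [i|v' v'E]; first by rewrite compA vE tE.
by apply: vU; apply: (coproduct_ext copP) => i; rewrite -compA v'E tE.
Qed.

Section Systems.
Variables (A : preadditiveCategory) (I : Type) (le : I -> I -> Prop).

(** The transition maps of a family of subobjects of X ordered by le need not be
    given: they are determined by the monomorphisms into X, and therefore
    satisfy the functoriality laws.  Dually for a family of quotients. *)
Section Subobjects.
Variables (X : A) (K : I -> A) (k : forall i, Hom (K i) X).
Hypothesis k_monic : forall i, monic (k i).
Hypothesis k_le : forall i j, le i j -> exists v, k j \oc v = k i.

Definition subobject_map i j (ij : le i j) := projT1 (cid (k_le ij)).

Lemma subobject_mapE i j (ij : le i j) : k j \oc subobject_map ij = k i.
Proof. by rewrite /subobject_map; case: cid. Qed.

Fact subobject_map1 i (ii : le i i) : subobject_map ii = idm (K i).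
Proof. by apply: k_monic; rewrite subobject_mapE compm1. Qed.

Fact subobject_mapM i j l (ij : le i j) (jl : le j l) (il : le i l) :
  subobject_map jl \oc subobject_map ij = subobject_map il.
Proof. by apply: k_monic; rewrite compA !subobject_mapE. Qed.

Definition subobject_system := DirectSystem subobject_map1 subobject_mapM.

End Subobjects.

Section Quotients.
Variables (P : A) (H : I -> A) (q : forall i, Hom P (H i)).
Hypothesis q_epic : forall i, epic (q i).
Hypothesis q_le : forall i j, le i j -> exists v, v \oc q i = q j.

Definition quotient_map i j (ij : le i j) := projT1 (cid (q_le ij)).

Lemma quotient_mapE i j (ij : le i j) : quotient_map ij \oc q i = q j.
Proof. by rewrite /quotient_map; case: cid. Qed.

Fact quotient_map1 i (ii : le i i) : quotient_map ii = idm (H i).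
Proof. by apply: q_epic; rewrite quotient_mapE comp1m. Qed.

Fact quotient_mapM i j l (ij : le i j) (jl : le j l) (il : le i l) :
  quotient_map jl \oc quotient_map ij = quotient_map il.
Proof. by apply: q_epic; rewrite -compA !quotient_mapE. Qed.

Definition quotient_system := DirectSystem quotient_map1 quotient_mapM.

End Quotients.

Section Constant.
Variable X : A.

Definition constant_system := DirectSystem
  (dsobj := fun _ : I => X) (dsmap := fun i j (_ : le i j) => idm X)
  (fun _ _ => erefl) (fun _ _ _ _ _ _ => comp1m (idm X)).

Lemma constant_direct_limit : directed le ->
  is_direct_limit (F := constant_system) (fun _ => idm X).
Proof.
move=> [[i0] _ _ dir]; split=> [i j ij|W u u_cocone]; first exact: comp1m.
exists (u i0); split=> [i|v vE]; last by rewrite -(vE i0) compm1.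
have [j ij i0j] := dir i i0; rewrite compm1.
have := u_cocone _ _ ij; rewrite -(u_cocone _ _ i0j) /= !compm1 => <-.
by [].
Qed.

End Constant.

End Systems.

(** * Unions of preimages *)

(** Let K i be the kernel of q i \oc w.  The sequences K i -> X -> H i are
    exact, and the hypothesis on the quotients H i of P says that their direct
    limit is 0.  By AB5 the limit sequence L -> X -> 0 is exact, so that X is
    the union of the K i, on which t is assumed to vanish. *)
Lemma AB5_kernels_eq0 (A : grothendieckCategory) (I : Type)
    (le : I -> I -> Prop) (P : A) (H : I -> A) (q : forall i, Hom P (H i)) :
    directed le -> (forall i, epic (q i)) ->
    (forall i j, le i j -> exists v, v \oc q i = q j) ->
    (forall W (t : Hom P W), (forall i, exists u, u \oc q i = t) -> t = 0) ->
  forall (X Y : A) (w : Hom X P) (t : Hom X Y),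
    (forall i Z (v : Hom Z X), q i \oc (w \oc v) = 0 -> t \oc v = 0) -> t = 0.
Proof.
move=> le_dir q_epic q_le q_lim X Y w t t0.
have [_ _ _ le_ub] := le_dir.
have [Z [_ Zfrom]] := has_zero_object (abelianP A).
pose kerP i := cid (has_kernels (abelianP A) (q i \oc w)).
pose K i := projT1 (kerP i).
pose k i : Hom (K i) X := projT1 (cid (projT2 (kerP i))).
have kK i : is_kernel (q i \oc w) (k i) by apply: projT2 (cid _).
have k_le i j : le i j -> exists v, k j \oc v = k i.
  move=> /q_le[h hE]; have [|v [vE _]] := (kK j).2 _ (k i); last by exists v.
  by rewrite -hE -!compA (compA (q i)) (kK i).1 compm0.
have k_monic i : monic (k i) := kernel_monic (kK i).
pose F := subobject_system k_monic k_le; pose G := constant_system le X.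
pose Q := quotient_system q_epic q_le.
have [L [c limF]] := AB3_direct_limit (@grothendieck_AB3 A) F.
have limQ : is_direct_limit (F := Q) (fun i => 0 : Hom (H i) Z).
  split=> [i j ij|W u u_cocone]; first by rewrite comp0m.
  (* u i \oc q i does not depend on i, because le is directed. *)
  have uq0 i : u i \oc q i = 0.
    apply: q_lim => j; exists (u j).
    have [l il jl] := le_ub i j.
    rewrite -(u_cocone _ _ il) -(u_cocone _ _ jl) -!compA.
    by rewrite !(quotient_mapE q_le).
  exists 0; split=> [i|v _]; last by rewrite (Zfrom _ v).
  by rewrite comp0m; apply: (q_epic i); rewrite comp0m.
have [l [lE _]] := limF.2 X k (fun i j ij => subobject_mapE k_le ij).
have [||||| K' [k' [e [[_ kerU] e_epic kel]]]] :=
    @grothendieck_AB5 A I le le_dir F G Q k (fun i => q i \oc w) _ _ _ L X Z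
      c (fun=> idm X) (fun=> 0) limF (constant_direct_limit X le_dir) limQ l 0.
- by move=> i j ij; rewrite (subobject_mapE k_le) comp1m.
- by move=> i j ij; rewrite compm1 compA (quotient_mapE q_le).
- by move=> i; exists (K i), (k i), (idm _); split=> //;
    [move=> ? ? ?; rewrite !compm1 | rewrite compm1].
- by move=> i; rewrite lE comp1m.
- by move=> i; rewrite !comp0m.
(* k' is a kernel of the zero morphism on X, hence has a right inverse. *)
have [r [rE _]] := kerU X (idm X) (comp0m _ _).
have tl0 : t \oc l = 0.
  have [v [_ vU]] := limF.2 Y (fun i => 0 : Hom (F i) Y)
    (fun i j ij => comp0m _ _).
  rewrite -(vU 0) => [|i]; last by rewrite comp0m.
  apply/esym/vU => i; rewrite -compA lE.
  by apply: (t0 i); rewrite compA (kK i).1.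
rewrite -(compm1 t) -rE compA; suff -> : t \oc k' = 0 by rewrite comp0m.
by apply: e_epic; rewrite -compA kel tl0 comp0m.
Qed.

(** The morphisms w \oc v that are finite sums through the inj i are those which
    factor through a finite subcoproduct, so the assumption on t is that it
    vanishes on the preimage under w of each finite subcoproduct.  These
    subcoproducts are represented by the idempotents e s of P, s a finite list
    of indices, and the quotients required by AB5_kernels_eq0 are the
    cokernels of the e s. *)
Lemma coproduct_eq0 (A : grothendieckCategory) (U : A) (J : eqType)
    (P : A) (inj : J -> Hom U P) :
    is_coproduct inj ->
  forall (X Y : A) (w : Hom X P) (t : Hom X Y),
    (forall Z (v : Hom Z X) (s : seq J) (r : J -> Hom Z U),
       w \oc v = \sum_(i <- s) inj i \oc r i -> t \oc v = 0) -> t = 0.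
Proof.
move=> copP X Y w t t0.
pose proj i := projT1 (cid (copP U (fun j => if j == i then idm U else 0))).
have projE i j : proj i \oc inj j = if j == i then idm U else 0.
  by rewrite /proj; case: cid => ? [/= ->].
pose e (s : seq J) := \sum_(i <- undup s) inj i \oc proj i.
have eE s j : e s \oc inj j = if j \in s then inj j else 0.
  rewrite comp_suml; under eq_bigr do rewrite -compA projE.
  rewrite -mem_undup; case: ifP => js.
    rewrite (bigD1_seq j) ?undup_uniq //= eqxx compm1 big1 ?addr0 // => i.
    by rewrite eq_sym => /negPf ->; rewrite compm0.
  rewrite big_seq big1 // => i si; case: eqP => [ji|_]; last exact: compm0.
  by rewrite ji si in js.
pose cokP s := cid (has_cokernels (abelianP A) (e s)).
pose H s := projT1 (cokP s).
pose q s : Hom P (H s) := projT1 (cid (projT2 (cokP s))).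
have qK s : is_cokernel (e s) (q s) by apply: projT2 (cid _).
pose le (s s' : seq J) : Prop := {subset s <= s'}.
apply: (@AB5_kernels_eq0 A (seq J) le P H q _ _ _ _ X Y w t).
- split=> [||s1 s2 s3 s12 s23 i /s12/s23//|s1 s2]; first exact: inhabits [::].
    by move=> s i.
  by exists (s1 ++ s2) => i si; rewrite mem_cat si ?orbT.
- by move=> s; apply: cokernel_epic (qK s).
- move=> s s' ss'; have [|v [vE _]] := (qK s).2 _ (q s'); last by exists v.
  suff -> : e s = e s' \oc e s by rewrite compA (qK s').1 comp0m.
  apply: (coproduct_ext copP) => j; rewrite -compA eE.
  by case: ifP => [/ss' s'j|_]; rewrite ?compm0 // eE s'j.
- move=> W u uq; apply: (coproduct_ext copP) => j; rewrite comp0m.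
  have [v <-] := uq [:: j].
  suff -> : inj j = e [:: j] \oc inj j.
    by rewrite -(compA v) (compA (q _)) (qK _).1 comp0m compm0.
  by rewrite eE mem_head.
- move=> s Z v qwv0; apply: (t0 Z v (undup s) (fun i => proj i \oc (w \oc v))).
  (* idm P - e s factors through q s, so that e s fixes w \oc v. *)
  have [|h [hE _]] := (qK s).2 _ (idm P - e s).
    apply: (coproduct_ext copP) => j.
    rewrite comp0m compBl comp1m compBl -compA eE.
    by case: ifP => sj; rewrite ?eE ?sj ?compm0 subrr.
  have := congr1 (fun g => g \oc (w \oc v)) hE.
  rewrite /= -compA qwv0 compm0 compBl comp1m => /esym/eqP.
  rewrite subr_eq0 => /eqP {1}->; rewrite comp_suml.
  by apply: eq_bigr => i _; rewrite -compA.
Qed.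

(** * The functor Hom(U, -) *)

(** The fullness half of the Gabriel-Popescu theorem. *)
Lemma homFunctor_full (A : grothendieckCategory) (U M N : A) :
  is_generator U -> forall phi : Hom (homFunctor U M) (homFunctor U N),
  exists f, fmap (homFunctor U) f = phi.
Proof.
move=> hU phi0; pose phi : {linear homModule U M -> homModule U N} := phi0.
pose J : choiceType := Hom U M.
have [P [inj copP]] := @grothendieck_AB3 A J (fun _ : J => U).
have [p [pE _]] := copP M id.
have [t [tE _]] := copP N (fun j : J => phi j).
have t0 (w : Hom U P) : p \oc w = 0 -> t \oc w = 0.
  move=> pw0; apply: (coproduct_eq0 (J := J) copP (w := w)).
  (* Composing with x : U -> Z turns the coefficients r i into elements of R. *)
  move=> Z v s r wv; apply: hU => x; rewrite comp0m.
  have {}wv : w \oc (v \oc x) = \sum_(i <- s) inj i \oc (r i \oc x).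
    by rewrite compA wv comp_suml; apply: eq_bigr => i _; rewrite compA.
  rewrite -!compA wv comp_sumr.
  under eq_bigr do rewrite compA tE.
  (* In Hom(U, M) the action of R is composition on the right. *)
  pose y : homModule U M := \sum_(i <- s)
    (r i \oc x : (End U)^c) *: (i : homModule U M).
  have -> : \sum_(i <- s) phi i \oc (r i \oc x) = phi y.
    by rewrite linear_sum; apply: eq_bigr => i _; rewrite linearZ.
  suff -> : y = 0 by rewrite linear0.
  have := congr1 (fun h => p \oc h) wv; rewrite compA pw0 comp0m comp_sumr.
  move=> /esym sum0; apply: etrans sum0.
  by apply: (@eq_bigr (homModule U M)) => i _; rewrite compA pE.
have p_epic : epic p.
  move=> W u v uv; apply: hU => x; have /(congr1 (fun h => h \oc inj x)) := uv.
  by rewrite -!compA pE.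
have [Z [g [pg0 pU]]] := epic_normal (abelianP A) p_epic.
have [|f [fE _]] := pU N t.
  by apply: hU => x; rewrite comp0m -compA t0 // compA pg0 comp0m.
by exists f; apply: linear_ext => x; rewrite /= /hom_map -{1}(pE x) compA fE tE.
Qed.

Lemma homFunctor_kernel (C : preadditiveCategory) (U X Y K : C) (f : Hom X Y)
    (k : Hom K X) :
  is_kernel f k ->
  is_kernel (fmap (homFunctor U) f) (fmap (homFunctor U) k).
Proof.
move=> kerk; apply: rMod_is_kernel => [x y|x].
  exact: kernel_monic kerk _ _ _.
split=> [fx0|[y <-]]; first by have [y [yE _]] := kerk.2 _ _ fx0; exists y.
by rewrite /= /hom_map compA kerk.1 comp0m.
Qed.

Lemma homFunctor_faithful (C : preadditiveCategory) (U M N : C) :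
  is_generator U -> injective (@fmap _ _ (homFunctor U) M N).
Proof.
move=> hU f g fg; apply: hU => u.
exact: (congr1 (fun h : {linear homModule U M -> homModule U N} => h u) fg).
Qed.

Theorem corollary2p4 (A : grothendieckCategory) (U : A) (hU : is_generator U)
    (M N : A) :
  rickart (A := A) M N <->
  rickart (A := rMod (End U)) (homFunctor U M) (homFunctor U N).
Proof.
split=> [ricN g K k kerk|ricN f K k kerk].
  have [f fE] := homFunctor_full hU g.
  have [K0 [k0 kerk0]] := has_kernels (abelianP A) f.
  have := homFunctor_kernel U kerk0; rewrite fE => kerSk0.
  apply: (kernel_split_mono kerSk0 kerk); have [r rk0] := ricN f K0 k0 kerk0.
  by exists (fmap (homFunctor U) r); rewrite -fmapM rk0 fmap1.
have [r rSk] := ricN _ _ _ (homFunctor_kernel U kerk).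
have [r0 r0E] := homFunctor_full hU r.
exists r0; apply: (homFunctor_faithful hU).
by rewrite fmapM r0E rSk fmap1.
Qed.
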